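(* Let $G=(V,E,F)$ be a closed 2-cell embedding in a closed surface $\Sigma$ with $V=\{v_1,\dots,v_N\}$ and intersection angles $\Theta(e)\in(0,\frac{\pi}{2}]$, $e\in E$. Let $\hat L_v>0$ for each $v\in V$. Then for any initial data $r_0\in(0,\frac{\pi}{2})^N$, the flow $$\frac{\mathrm{d} r_v}{\mathrm{d}t}=\frac{L_v-\hat L_v}{2}\,\sin(2r_v),\qquad v\in V,$$ has a unique solution $r:[0,\infty)\to(0,\frac{\pi}{2})^N$ with $r(0)=r_0$. Respectively, for any initial data $K_0\in\mathbb{R}^N$, the flow $$\frac{\mathrm{d}K_v}{\mathrm{d}t}=-(L_v-\hat L_v),\qquad v\in V,$$ in the variables $K_v=\ln\cot r_v$, has a unique solution $K:[0,\infty)\to\mathbb{R}^N$ with $K(0)=K_0$. Here $L_v$ is the total geodesic curvature of the circle $C_v$, as a function of $r$ (equivalently of $K$).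
   Context: Graph embeddings. $(V,E)$ is a finite graph, $\Sigma$ a closed surface, and $\eta:V\cup E\to\Sigma$ a graph embedding; vertices and edges are identified with their images. A face is a connected component of $\Sigma\setminus\eta(V\cup E)$, and $F$ is the set of faces. The embedding is a closed 2-cell embedding if the closure of every face is homeomorphic to a closed disk and every face is bounded by a simple closed curve consisting of finitely many edges. An edge with endpoints $u,w$ is written $e=\{u,w\}$, and $v<e$ means that the vertex $v$ is incident to the edge $e$. Incidence graph. Put an auxiliary vertex $v_f$ in the interior of each face $f$. The incidence graph $I(G)$ is the bipartite graph with parts $V$ and $V_F=\{v_f: f\in F\}$, where $v\in V$ and $v_f$ are adjacent iff $v$ is on the boundary of $f$. It induces a closed 2-cell embedding with quadrilateral faces, and each $e\in E$ is contained in a unique such quadrilateral. Spherical metric and circle pattern. Given radii $r=(r_v)_{v\in V}\in(0,\frac{\pi}{2})^N$ and intersection angles $\Theta(e)$, for each edge $e=\{u,w\}$ give the associated quadrilateral $uAwB$ (with $A,B\in V_F$) the metric of a spherical quadrilateral (on the unit sphere) with $|uA|=|uB|=r_u$, $|wA|=|wB|=r_w$ and $\angle uAw=\angle uBw=\pi-\Theta(e)$ (the union of two congruent spherical triangles $uAw$ and $uBw$ along the side $uw$). Its angle at $u$ is $2\beta_{u,e}$, where $\beta_{u,e}\in(0,\pi)$ is the angle at $u$ in the spherical triangle $uAw$ with side lengths $|uA|=r_u$, $|wA|=r_w$ and angle $\pi-\Theta(e)$ at $A$. Gluing these quadrilaterals along the common edges of $I(G)$ gives a piecewise spherical metric $S(\Sigma)$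 on $\Sigma$ with possible conic singularities. $C_v$ is the circle with center $v$ and radius $r_v$ in $S(\Sigma)$. Total geodesic curvature. The cone angle at $v\in V$ is $\alpha_v=\sum_{e: v<e}2\beta_{v,e}$. The circle $C_v$ has geodesic curvature $k_v=\cot r_v$ and length $l_v=\alpha_v\sin r_v$, and its total geodesic curvature is $L_v=l_vk_v=\alpha_v\cos r_v$. The map $r\mapsto K$, $K_v=\ln\cot r_v=\ln k_v$, is a bijection from $(0,\frac{\pi}{2})^N$ to $\mathbb{R}^N$. *)

(* Defs.v *)
From HB Require Import structures.
From mathcomp Require Import all_boot all_order all_algebra.
From mathcomp Require Import all_classical all_reals all_analysis.
From mathcomp Require Import ring lra.
Set Implicit Arguments.
Unset Strict Implicit.
Unset Printing Implicit Defensive.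
Import Order.TTheory GRing.Theory Num.Theory.
Import numFieldNormedType.Exports.
Local Open Scope classical_set_scope.
Local Open Scope ring_scope.

(** * Closed surfaces and closed 2-cell embeddings *)

Definition homeomorphic_sets (X Y : topologicalType) (A : set X) (B : set Y) :=
  exists (f : X -> Y) (g : Y -> X),
    [/\ {within A, continuous f}, {within B, continuous g},
        forall x, A x -> B (f x) /\ g (f x) = x
      & forall y, B y -> A (g y) /\ f (g y) = y].

Definition closed_disk (R : realType) : set (R * R) :=
  [set p | p.1 ^+ 2 + p.2 ^+ 2 <= 1].

Definition unit_circle (R : realType) : set (R * R) :=
  [set p | p.1 ^+ 2 + p.2 ^+ 2 = 1].

(* Second countability is automatic for a compact locally Euclidean space. *)
Definition closed_surface (R : realType) (S : topologicalType) :=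
  [/\ [set: S] !=set0, compact [set: S], connected [set: S],
      hausdorff_space S
    & forall x : S, exists U : set S,
        [/\ open U, U x & homeomorphic_sets U [set: R * R]]].

(* A finite graph has finite types V of vertices and E of edges, the edge e
   joining the two elements of [ends e]; thus [v \in ends e] means v < e.  There
   are no loops, but distinct edges may have the same ends.
   [eta_e e] is the closed arc that is the image of e, ends included. *)
Definition graph_embedding (R : realType) (S : topologicalType) (V E : finType)
    (ends : E -> {set V}) (eta_v : V -> S) (eta_e : E -> set S) :=
  [/\ forall e, #|ends e| = 2%N,
      injective eta_v,
      forall e, exists gamma : R -> S,
        [/\ {within `[0, 1], continuous gamma},
            {in `[0, 1] &, injective gamma},
            eta_e e = gamma @` `[0, 1]
          & eta_v @` [set` ends e] = [set gamma 0; gamma 1]],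
      forall e v, eta_e e (eta_v v) -> v \in ends e
    & forall e e', e <> e' ->
        eta_e e `&` eta_e e' `<=` eta_v @` [set` ends e :&: ends e']].

Definition graph_image (S : topologicalType) (V E : finType)
    (eta_v : V -> S) (eta_e : E -> set S) : set S :=
  range eta_v `|` \bigcup_(e in [set: E]) eta_e e.

Definition is_face (S : topologicalType) (V E : finType)
    (eta_v : V -> S) (eta_e : E -> set S) (f : set S) :=
  exists2 x, (~` graph_image eta_v eta_e) x &
    f = connected_component (~` graph_image eta_v eta_e) x.

Definition closed_2cell_embedding (R : realType) (S : topologicalType)
    (V E : finType) (ends : E -> {set V}) (eta_v : V -> S)
    (eta_e : E -> set S) :=
  graph_embedding R ends eta_v eta_e /\
  forall f, is_face eta_v eta_e f ->
    [/\ homeomorphic_sets (closure f) (@closed_disk R),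
        homeomorphic_sets (closure f `\` f°) (@unit_circle R)
      & exists B : {set E}, closure f `\` f° = \bigcup_(e in [set` B]) eta_e e].

(** * Triangles on the unit sphere of R^3 *)

Section Sphere.
Variable R : realType.
Implicit Types (p q s A u w : 'rV[R]_3) (a b g : R).

Definition dot p q : R := \sum_i p 0 i * q 0 i.

Definition on_sphere p := dot p p = 1.

Definition sphere_dist p q := acos (dot p q).

(* The direction at p, in the tangent plane of the sphere, of the shortest arc
   of great circle from p to q. *)
Definition tangent_dir p q := q - dot p q *: p.

Definition vec_angle p q :=
  acos (dot p q / (Num.sqrt (dot p p) * Num.sqrt (dot q q))).

(* The angle at p of the spherical triangle p q s. *)
Definition sphere_angle p q s := vec_angle (tangent_dir p q) (tangent_dir p s).

Definition vec3 a b c : 'rV[R]_3 := \row_j [:: a; b; c]`_j.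

(* The triangle u A w with |uA| = a, |wA| = b and angle g at A, placed with A at
   the north pole; see [triangle_sas] and [triangle_angle_unique]. *)
Definition apex := vec3 0 0 1.
Definition vertex_u a := vec3 (sin a) 0 (cos a).
Definition vertex_w b g := vec3 (sin b * cos g) (sin b * sin g) (cos b).

Definition triangle_angle a b g :=
  sphere_angle (vertex_u a) apex (vertex_w b g).

Lemma dot_vec3 a b c a' b' c' :
  dot (vec3 a b c) (vec3 a' b' c') = a * a' + b * b' + c * c'.
Proof. by rewrite /dot !big_ord_recl big_ord0 !mxE /= addr0 addrA. Qed.

Lemma dotC p q : dot p q = dot q p.
Proof. by apply: eq_bigr => i _; rewrite mulrC. Qed.

Lemma dotBl p q s : dot (p - q) s = dot p s - dot q s.
Proof.
by rewrite /dot -sumrB; apply: eq_bigr => i _; rewrite !mxE mulrBl.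
Qed.

Lemma dotZl c p q : dot (c *: p) q = c * dot p q.
Proof. by rewrite /dot mulr_sumr; apply: eq_bigr => i _; rewrite !mxE mulrA. Qed.

Lemma dot_ge0 p : 0 <= dot p p.
Proof. by apply: sumr_ge0 => i _; rewrite -expr2 sqr_ge0. Qed.

Lemma dot_unit_itv p q : on_sphere p -> on_sphere q -> -1 <= dot p q <= 1.
Proof.
rewrite /on_sphere => hp hq.
have := dot_ge0 (p - q); have := dot_ge0 (p - (-1) *: q).
rewrite !(dotBl, dotZl) ![dot _ (_ - _)]dotC !(dotBl, dotZl) hp hq (dotC q p).
by move=> h1 h2; lra.
Qed.

Lemma vec_angle_itv p q : 0 < dot p p -> 0 < dot q q ->
  -1 <= dot p q / (Num.sqrt (dot p p) * Num.sqrt (dot q q)) <= 1.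
Proof.
move=> hp hq.
have sp : Num.sqrt (dot p p) != 0 by rewrite gt_eqF ?sqrtr_gt0.
have sq : Num.sqrt (dot q q) != 0 by rewrite gt_eqF ?sqrtr_gt0.
have U (x : 'rV[R]_3) : 0 < dot x x ->
    on_sphere ((Num.sqrt (dot x x))^-1 *: x).
  move=> hx; rewrite /on_sphere dotZl dotC dotZl mulrA -invfM -expr2.
  by rewrite sqr_sqrtr ?ltW // mulVf // gt_eqF.
have := dot_unit_itv (U _ hp) (U _ hq).
by rewrite dotZl dotC dotZl (dotC q p) mulrA -invfM [dot p q / _]mulrC.
Qed.

Lemma dot_tangent p q s : on_sphere p ->
  dot (tangent_dir p q) (tangent_dir p s) = dot q s - dot p q * dot p s.
Proof.
rewrite /on_sphere /tangent_dir => hp.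
rewrite dotBl dotZl dotC dotBl dotZl (dotC p (_ - _)) dotBl dotZl hp.
by rewrite (dotC s q) (dotC s p); ring.
Qed.

Lemma sphere_angleE p q s : on_sphere p -> on_sphere q -> on_sphere s ->
  sphere_angle p q s = acos ((dot q s - dot p q * dot p s) /
    (Num.sqrt (1 - dot p q ^+ 2) * Num.sqrt (1 - dot p s ^+ 2))).
Proof.
move=> hp hq hs; rewrite /sphere_angle /vec_angle !dot_tangent //.
by rewrite hq hs !expr2.
Qed.

Lemma apex_sphere : on_sphere apex.
Proof. by rewrite /on_sphere dot_vec3; ring. Qed.

Lemma vertex_u_sphere a : on_sphere (vertex_u a).
Proof. by rewrite /on_sphere dot_vec3 -(cos2Dsin2 a); ring. Qed.

Lemma vertex_w_sphere b g : on_sphere (vertex_w b g).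
Proof.
rewrite /on_sphere dot_vec3 -[RHS](cos2Dsin2 b).
rewrite -[sin b ^+ 2]mulr1 -(cos2Dsin2 g); ring.
Qed.

Lemma sqrt_sin a : 0 < a < pi -> Num.sqrt (1 - cos a ^+ 2) = sin a.
Proof.
move=> /andP[a0 api]; rewrite -sin2cos2 sqrtr_sqr ger0_norm //.
by rewrite sin_ge0_pi // !ltW.
Qed.

Lemma triangle_sas a b g : 0 < a < pi -> 0 < b < pi -> 0 <= g <= pi ->
  [/\ sphere_dist (vertex_u a) apex = a, sphere_dist (vertex_w b g) apex = b
    & sphere_angle apex (vertex_u a) (vertex_w b g) = g].
Proof.
move=> ha hb hg.
have itv (x : R) : 0 < x < pi -> x \in `[0, pi].
  by move=> /andP[x0 x1]; rewrite in_itv /= !ltW.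
have sa : sin a != 0 by rewrite gt_eqF ?sin_gt0_pi.
have sb : sin b != 0 by rewrite gt_eqF ?sin_gt0_pi.
rewrite /sphere_dist sphere_angleE; [|exact: apex_sphere
  |exact: vertex_u_sphere|exact: vertex_w_sphere].
rewrite !dot_vec3 !(mulr0, mul0r, mulr1, mul1r, add0r, addr0).
rewrite !sqrt_sin // addrK.
have -> : sin a * (sin b * cos g) / (sin a * sin b) = cos g.
  by field; rewrite sa sb.
by split; apply: cosK; [exact: itv|exact: itv|rewrite in_itv].
Qed.

Lemma triangle_angle_unique A u w a b g :
  on_sphere A -> on_sphere u -> on_sphere w ->
  0 < a < pi -> 0 < b < pi ->
  sphere_dist u A = a -> sphere_dist w A = b -> sphere_angle A u w = g ->
  sphere_angle u A w = triangle_angle a b g.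
Proof.
move=> hA hu hw ha hb ua wb ug.
have uA : dot u A = cos a by rewrite -ua acosK // in_itv /= dot_unit_itv.
have wA : dot w A = cos b by rewrite -wb acosK // in_itv /= dot_unit_itv.
have sa : 0 < sin a by rewrite sin_gt0_pi.
have sb : 0 < sin b by rewrite sin_gt0_pi.
have cg : dot u w = cos a * cos b + sin a * sin b * cos g.
  have E (p : 'rV[R]_3) (c : R) : 0 < c < pi -> on_sphere p -> dot p A = cos c ->
      0 < dot (tangent_dir A p) (tangent_dir A p).
    move=> hc hp hpA.
    rewrite dot_tangent // hp dotC hpA -expr2 -sin2cos2.
    by rewrite exprn_gt0 // sin_gt0_pi.
  have := vec_angle_itv (E _ _ ha hu uA) (E _ _ hb hw wA).
  move: ug; rewrite /sphere_angle /vec_angle.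
  rewrite !dot_tangent // hu hw !(dotC A) uA wA -!expr2 !sqrt_sin // => <- I.
  by rewrite acosK ?in_itv //=; field; rewrite !gt_eqF.
rewrite /triangle_angle !sphere_angleE //; [|exact: vertex_u_sphere
  |exact: apex_sphere|exact: vertex_w_sphere].
rewrite (dotC A w) uA wA cg !dot_vec3.
rewrite !(mulr0, mul0r, mulr1, mul1r, add0r, addr0).
by congr (acos (_ / (_ * Num.sqrt (1 - _ ^+ 2)))); ring.
Qed.

End Sphere.

(** * Total geodesic curvature of the circles of the pattern *)

Section Pattern.
Variables (R : realType) (V E : finType) (ends : E -> {set V}).
Variable Theta : E -> R.
Implicit Types (r K : V -> R) (v : V) (e : E).

Definition cot (x : R) : R := cos x / sin x.

(* beta_{v,e} for the edge e = {v, w}. *)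
Definition beta r v w e := triangle_angle (r v) (r w) (pi - Theta e).

(* The inner sum has a single term, the end of e other than v. *)
Definition cone_angle r v : R :=
  \sum_(e | v \in ends e) \sum_(w in ends e :\ v) 2 * beta r v w e.

Definition geodesic_curvature r v : R := cot (r v).

Definition circle_length r v : R := cone_angle r v * sin (r v).

Definition total_curvature r v : R := circle_length r v * geodesic_curvature r v.

Definition admissible_radii : set (V -> R) :=
  [set r | forall v, 0 < r v < pi / 2].

Definition log_curvature r v : R := ln (cot (r v)).

(* The inverse of [log_curvature]; see the two cancellation lemmas. *)
Definition radius_of K v : R := atan (expR (- K v)).

Lemma total_curvatureE r v : admissible_radii r ->
  total_curvature r v = cone_angle r v * cos (r v).
Proof.
move=> /(_ v)/andP[r0 r1].
have s0 : sin (r v) != 0.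
  by rewrite gt_eqF // sin_gt0_pi // r0 (lt_trans r1) //
    ltr_pdivrMr ?ltr_pMr ?pi_gt0 ?ltr1n.
by rewrite /total_curvature /circle_length /geodesic_curvature /cot; field.
Qed.

Lemma radius_of_admissible K : admissible_radii (radius_of K).
Proof.
move=> v; have [/andP[_ h] t] := atan_def (expR (- K v)).
rewrite /radius_of h andbT -(atan0 R).
exact/lt_atan/expR_gt0.
Qed.

Lemma radius_ofK K : log_curvature (radius_of K) =1 K.
Proof.
move=> v; rewrite /log_curvature /cot -invf_div.
by rewrite -/(tan _) /radius_of atanK -expRN opprK expRK.
Qed.

Lemma log_curvatureK r : admissible_radii r ->
  radius_of (log_curvature r) =1 r.
Proof.
move=> ar v; have /andP[r0 r1] := ar v.
have p2 : 0 < (pi : R) / 2 by rewrite divr_gt0 ?pi_gt0.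
have s0 : 0 < sin (r v).
  by rewrite sin_gt0_pi // r0 (lt_trans r1) // ltr_pdivrMr ?ltr_pMr ?pi_gt0 ?ltr1n.
have c0 : 0 < cos (r v).
  by rewrite cos_gt0_pihalf // r1 andbT (lt_trans _ r0) // oppr_lt0.
rewrite /radius_of /log_curvature expRN lnK ?posrE ?divr_gt0 // /cot invf_div.
rewrite -/(tan _) tanK // in_itv /= r1 andbT (lt_trans _ r0) //.
by rewrite oppr_lt0.
Qed.

End Pattern.

(** * Flows on [0, +oo) *)

(* The derivative of f at t relative to D: two-sided in the interior of D,
   one-sided at an end point of an interval D. *)
Definition has_derivative_within (R : realType) (D : set R) (f : R -> R)
    (t l : R) :=
  (f s - f t) / (s - t) @[s --> within D t^'] --> l.

(* x is a solution, on [0, +oo) and with values in D, of x' = F(x), x(0) = x0;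
   its values at negative times are irrelevant. *)
Definition flow_solution (R : realType) (V : finType) (D : set (V -> R))
    (F : (V -> R) -> V -> R) (x0 : V -> R) (x : R -> V -> R) :=
  [/\ x 0 = x0,
      forall t, 0 <= t -> D (x t)
    & forall t v, 0 <= t ->
        has_derivative_within `[0, +oo[ (fun s => x s v) t (F (x t) v)].

Definition has_unique_flow_solution (R : realType) (V : finType)
    (D : set (V -> R)) (F : (V -> R) -> V -> R) (x0 : V -> R) :=
  exists x, flow_solution D F x0 x /\
    forall y, flow_solution D F x0 y -> forall t, 0 <= t -> y t = x t.

Definition radius_flow (R : realType) (V E : finType) (ends : E -> {set V})
    (Theta : E -> R) (Lhat : V -> R) (r : V -> R) (v : V) : R :=
  (total_curvature ends Theta r v - Lhat v) / 2 * sin (2 * r v).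

Definition log_curvature_flow (R : realType) (V E : finType)
    (ends : E -> {set V}) (Theta : E -> R) (Lhat : V -> R) (K : V -> R)
    (v : V) : R :=
  - (total_curvature ends Theta (radius_of K) v - Lhat v).

(* Main.v *)
Require Import Defs.
From mathcomp Require Import all_boot all_order all_algebra.
From mathcomp Require Import all_classical all_reals all_analysis.
From mathcomp Require Import ring lra.
Set Implicit Arguments.
Unset Strict Implicit.
Unset Printing Implicit Defensive.
Import Order.TTheory GRing.Theory Num.Theory.
Import numFieldNormedType.Exports.
Local Open Scope classical_set_scope.
Local Open Scope ring_scope.

(** The logarithmic flow K' = - (L(K) - Lhat) has a bounded and globally
    Lipschitz right-hand side on R^V, so it has a unique solution for all
    times; the radius flow is the same flow read through the diffeomorphism
    r = arctan (exp (- K)) from R to the interval from 0 to pi / 2, hence its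
    solutions can never leave that interval.

    The point is the Lipschitz bound, [log_curvature_flow_lipschitz].  The
    four-part formula of spherical trigonometry ([triangle_angleE]) gives, for
    an edge with log-curvatures x and y at its ends and angle theta,
      cot beta = (exp (y - x) + cos theta) * cos (arctan (exp (- x))) / sin theta.
    As cos theta >= 0, all the factors are nonnegative, and a change of x and y
    by at most d changes each factor by a factor of at most exp (2 d) or exp d;
    so ln (cot beta) is Lipschitz in (x, y) ([angle_cot_le]).  Moreover beta is a
    Lipschitz function of ln (cot beta), so beta is a bounded Lipschitz function
    of (x, y), and so is each term 2 beta cos r of the total curvature.

    The global Cauchy-Lipschitz theorem for a bounded field
    ([bounded_lipschitz_flow]) is proved with antiderivatives and the mean value
    theorem only.  Errors are measured against the weight exp (2 L t), whose
    derivative is 2 L times itself: one Picard step then halves the error on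
    the whole half-line ([driven_by_contraction]).  This one estimate gives the
    convergence of the Picard iterates, the fact that their limit is a solution,
    and uniqueness. *)

(** * One-sided derivatives and the mean value inequality *)

Section Calculus.
Variable R : realType.
Implicit Types (f g F : R -> R) (s t l : R).

Lemma has_derivative_withinP (D : set R) f t l :
  has_derivative_within D f t l <->
  forall e, 0 < e -> \forall s \near t, s != t -> D s ->
    `|l - (f s - f t) / (s - t)| < e.
Proof.
rewrite /has_derivative_within; split.
  move=> /cvgrPdist_lt H e e0; have := H e e0.
  by rewrite near_withinE near_withinE; apply: filterS => s /[swap] st /(_ st).
move=> H; apply/cvgrPdist_lt => e e0; have := H e e0.
by rewrite near_withinE near_withinE; apply: filterS => s P st Ds; exact: P.
Qed.

Lemma is_deriveP f t l :
  is_derive t 1 f l <-> has_derivative_within setT f t l.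
Proof.
rewrite has_derivative_withinP.
have E h : h^-1 *: ((f \o shift t) (h *: (1 : R)) - f t) =
    (f (h + t) - f t) / (h + t - t).
  by rewrite addrK /= [h%:A]mulr1 [LHS]mulrC.
split.
  move=> [D <-] e e0.
  have /cvgrPdist_lt /(_ e e0) := D; rewrite near_withinE.
  rewrite [X in _ -> X](near_shift 0) => H; near=> h => /= + _.
  rewrite subr0 => h0; rewrite -E; have : h != 0.
    by apply: contra_neq h0 => ->; rewrite add0r.
  by near: h.
move=> H.
have C : h^-1 *: ((f \o shift t) (h *: (1 : R)) - f t) @[h --> 0^'] --> l.
  apply/cvgrPdist_lt => e e0; have := H e e0.
  rewrite near_withinE [X in X -> _](near_shift 0) => {}H; near=> h => h0.
  rewrite E; have /= : (shift (t - 0) h != t -> setT (shift (t - 0) h) ->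
    `|l - (f (shift (t - 0) h) - f t) / (shift (t - 0) h - t)| < e) by near: h.
  rewrite subr0; apply => //.
  by rewrite -subr_eq0 addrK.
by split; [exact: cvgP C|exact: cvg_lim C].
Unshelve. all: by end_near. Qed.

Lemma is_derive_within (D : set R) f g t l : D t ->
  (forall s, D s -> g s = f s) -> is_derive t 1 g l ->
  has_derivative_within D f t l.
Proof.
move=> Dt gf /is_deriveP/has_derivative_withinP H.
apply/has_derivative_withinP => e /H; apply: filterS => s P st Ds.
by rewrite -!gf //; exact: P.
Qed.

(** Extending a function on the half-line by its tangent at 0 turns the one-sided
    derivative at 0 into a two-sided one, so that the theorems on two-sided
    derivatives apply up to the end point. *)
Definition affine_extension f l s : R := if 0 <= s then f s else f 0 + s * l.

Lemma affine_extensionE f l s : 0 <= s -> affine_extension f l s = f s.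
Proof. by rewrite /affine_extension => ->. Qed.

Lemma is_derive_affine_extension f (df : R -> R) :
  (forall t, 0 <= t -> has_derivative_within `[0, +oo[ f t (df t)) ->
  forall t, 0 <= t -> is_derive t 1 (affine_extension f (df 0)) (df t).
Proof.
move=> H t t0; apply/is_deriveP/has_derivative_withinP => e e0.
have /has_derivative_withinP/(_ e e0) := H t t0.
have [tp|] := ltP 0 t.
  have Np : \forall s \near t, 0 < s by exact: lt_nbhsr.
  apply: filterS2 Np => s sp P st _; rewrite !affine_extensionE // ?ltW //.
  by apply: P; rewrite //= in_itv /= andbT ltW.
move=> t0'; have {t0 t0'}-> : t = 0 by apply/eqP; rewrite eq_le t0 t0'.
apply: filterS => s P s0 _; rewrite [affine_extension _ _ 0]affine_extensionE //.
have [sp|sn] := leP 0 s.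
  by rewrite affine_extensionE //; apply: P; rewrite //= in_itv /= andbT.
rewrite /affine_extension leNgt sn /= addrAC subrr add0r subr0 mulrAC mulfV //.
by rewrite mul1r subrr normr0.
Qed.

Lemma has_derivative_within_comp (phi dphi f df : R -> R) :
  (forall t, 0 <= t -> has_derivative_within `[0, +oo[ f t (df t)) ->
  (forall t, 0 <= t -> is_derive (f t) 1 phi (dphi (f t))) ->
  forall t, 0 <= t ->
    has_derivative_within `[0, +oo[ (phi \o f) t (dphi (f t) * df t).
Proof.
move=> Hf Hphi t t0.
have Dg := is_derive_affine_extension Hf t0.
apply: (is_derive_within (g := phi \o affine_extension f (df 0))).
- by rewrite /= in_itv /= t0.
- by move=> s; rewrite /= in_itv /= andbT => s0; rewrite affine_extensionE.
- apply: is_derive1_comp.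
  by rewrite affine_extensionE //; exact: Hphi.
Qed.

Lemma is_derive_continuous_within f (df : R -> R) a b :
  (forall t, a <= t -> is_derive t 1 f (df t)) ->
  {within `[a, b], continuous f}.
Proof.
move=> H; apply: derivable_within_continuous => t.
by rewrite in_itv /= => /andP[/H[]].
Qed.

(** The mean value theorem makes both g - f and g + f nondecreasing. *)
Lemma derive_increment_le f g (df dg : R -> R) a b : a <= b ->
  (forall t, a <= t -> is_derive t 1 f (df t)) ->
  (forall t, a <= t -> is_derive t 1 g (dg t)) ->
  (forall t, a <= t -> `|df t| <= dg t) ->
  `|f b - f a| <= g b - g a.
Proof.
move=> ab Hf Hg fg.
have M (h dh : R -> R) : (forall t, a <= t -> is_derive t 1 h (dh t)) ->
    (forall t, a <= t -> 0 <= dh t) -> h a <= h b.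
  move=> Hh dh0.
  have [t /itvP tab | | t tab] := @MVT_segment R h dh a b ab.
  - by apply: Hh; rewrite tab.
  - exact: is_derive_continuous_within Hh.
  rewrite -subr_ge0 => ->; rewrite mulr_ge0 ?subr_ge0 // dh0 //.
  by rewrite (itvP tab).
have P t : a <= t -> - dg t <= df t <= dg t by move=> /fg; rewrite ler_norml.
have A : (g + f) a <= (g + f) b.
  apply: (M _ (fun t => dg t + df t)) => t at_.
    by have := Hf _ at_; have := Hg _ at_; exact: is_deriveD.
  by have := P _ at_; lra.
have B : (g - f) a <= (g - f) b.
  apply: (M _ (fun t => dg t - df t)) => t at_.
    by have := Hf _ at_; have := Hg _ at_; exact: is_deriveB.
  by have := P _ at_; lra.
rewrite ler_norml; move: A B; rewrite !fctE /= => A B.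
by apply/andP; split; lra.
Qed.

Lemma derive_bounded_lipschitz f (df : R -> R) (C a : R) :
  (forall t, a <= t -> is_derive t 1 f (df t)) ->
  (forall t, a <= t -> `|df t| <= C) ->
  forall s t, a <= s -> a <= t -> `|f s - f t| <= C * `|s - t|.
Proof.
move=> Hf HC.
have le s t : a <= t -> t <= s -> `|f s - f t| <= C * `|s - t|.
  move=> at_ ts; rewrite [`|s - t|]ger0_norm ?subr_ge0 // mulrBr.
  apply: (derive_increment_le (g := fun x => C * x) (dg := fun=> C) ts).
  - by move=> x tx; apply: Hf; rewrite (le_trans at_).
  - move=> x _; have : is_derive x (1 : R) (C \*: (@id R)) (C *: (1 : R^o)).
      exact: is_deriveZ.
    by rewrite [_ *: _]mulr1.
  - by move=> x tx; apply: HC; rewrite (le_trans at_).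
move=> s t as_ at_; have [ts|/ltW st] := leP t s; first exact: le.
by rewrite distrC (distrC s); exact: le.
Qed.

(** The fundamental theorem of calculus differentiates an integral only in the
    interior of its domain; integrating from -1 puts 0 in the interior. *)
Lemma lipschitz_antiderivative f (C : R) :
  (forall s t, 0 <= s -> 0 <= t -> `|f s - f t| <= C * `|s - t|) ->
  exists F, F 0 = 0 /\ forall t, 0 <= t -> is_derive t 1 F (f t).
Proof.
move=> lipf; pose h t := f (Num.max t 0).
have C0 : 0 <= C.
  by have := lipf 1 0 ler01 (lexx 0); rewrite subr0 normr1 mulr1; apply: le_trans.
have hc : continuous h.
  have maxL s t : `|Num.max s 0 - Num.max t 0| <= `|s - t|.
    have := ler_norm (s - t); have := ler_norm (t - s); rewrite distrC ler_norml.
    by rewrite !maxEle; case: (leP s 0); case: (leP t 0) => *; lra.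
  move=> t; apply/cvgrPdist_le => e e0.
  have C1 : 0 < C + 1 by lra.
  near=> s.
  rewrite /h (le_trans (lipf _ _ _ _)) ?le_max ?lexx ?orbT //.
  rewrite (le_trans (ler_wpM2l C0 (maxL _ _))) //.
  have : `|t - s| <= e / (C + 1).
    by near: s; apply: cvgr_dist_le; [exact: cvg_id|exact: divr_gt0].
  rewrite ler_pdivlMr // => ts; rewrite (le_trans _ ts) // mulrC.
  by rewrite ler_wpM2l // lerDl.
pose F t := (\int[@lebesgue_measure R]_(s in `[(-1 : R), t]) h s)%R.
exists (fun t => F t - F 0); split; first by rewrite subrr.
move=> t t0; have [||||dF F't] := @continuous_FTC1_closed R h (-1) t (t + 1).
- by rewrite ltrDl.
- apply: continuous_compact_integrable; first exact: segment_compact.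
  exact: continuous_subspaceT.
- by rewrite (lt_le_trans _ t0) // ltrN10.
- exact: hc.
have DF : is_derive t 1 F (f t).
  by apply: DeriveDef => //; rewrite -derive1E F't /h; rewrite max_l.
have : is_derive t 1 (F - cst (F 0)) (f t - 0) by exact: is_deriveB.
by rewrite subr0.
Unshelve. all: by end_near. Qed.

End Calculus.

(** * Bounded Lipschitz fields on R^V *)

Section GeometricErrors.
Variable R : realType.
Implicit Types (a b C : R).

Lemma le_add_geometric a b C : (forall n, a <= b + C / 2 ^+ n) -> a <= b.
Proof.
move=> H; rewrite leNgt; apply/negP => ba.
have d0 : 0 < a - b by rewrite subr_gt0.
have [n hn] : exists n : nat, C / (a - b) < n%:R.
  exists (Num.bound `|C / (a - b)|).
  by rewrite (le_lt_trans (ler_norm _)) // archi_boundP.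
have : a - b <= C / 2 ^+ n by rewrite lerBlDl.
rewrite ler_pdivlMr ?exprn_gt0 // => h.
have : C < 2 ^+ n * (a - b).
  rewrite -ltr_pdivrMr // (lt_trans hn) // -natrX ltr_nat; exact: ltn_expl.
by rewrite mulrC ltNge h.
Qed.

(** The intervals of radius 2 C / 2 ^ n around u n are nested, so the supremum of
    their lower ends lies in all of them. *)
Lemma geometric_increments_limit (u : nat -> R) C :
  (forall n, `|u n.+1 - u n| <= C / 2 ^+ n) ->
  exists l, forall n, `|u n - l| <= 2 * C / 2 ^+ n.
Proof.
move=> H; pose e n := 2 * C / 2 ^+ n.
have eS n : e n.+1 = e n - C / 2 ^+ n.
  by rewrite /e exprS; field; rewrite expf_neq0.
have e0 n : 0 <= e n.
  by have := H n; move=> /(le_trans (normr_ge0 _)); rewrite /e -mulrA; lra.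
have lo : {homo (fun n => u n - e n) : m n / (m <= n)%N >-> m <= n}.
  apply: homo_leq => [//||n]; first exact: le_trans.
  by have := H n; rewrite eS ler_norml => /andP[]; lra.
have hi : {homo (fun n => u n + e n) : m n / (m <= n)%N >-> n <= m}.
  apply: homo_leq => [//||n]; first by move=> ? ? ? /[swap]; exact: le_trans.
  by have := H n; rewrite eS ler_norml => /andP[]; lra.
have lohi m n : u m - e m <= u n + e n.
  apply: (le_trans (lo _ _ (leq_maxl m n))).
  apply: le_trans (hi _ _ (leq_maxr m n)).
  by have := e0 (maxn m n); lra.
pose A := range (fun n => u n - e n).
have ubA : has_ubound A by exists (u 0%N + e 0%N) => _ [n _ <-]; exact: lohi.
exists (sup A) => n; rewrite ler_distl.
have -> : u n <= sup A + e n.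
  by rewrite -lerBlDr; apply: ub_le_sup => //; exists n.
rewrite andbT lerBlDr.
by apply: ge_sup => [|_ [m _ <-] //]; exists (u 0%N - e 0%N); exists 0%N.
Qed.

End GeometricErrors.

Section BoundedLipschitzFlow.
Variables (R : realType) (V : finType) (F : (V -> R) -> V -> R) (B L : R).
Implicit Types (x y u w : R -> V -> R) (K : V -> R).

Hypothesis F_bounded : forall K (v : V), `|F K v| <= B.
Hypothesis L_gt0 : 0 < L.
Hypothesis F_lipschitz : forall K K' (d : R), (forall v, `|K v - K' v| <= d) ->
  forall v, `|F K v - F K' v| <= L * d.

(** The derivative of u is read off the field along another curve x: a Picard step
    leads from x to a u driven by x, and the solutions of the differential
    equation are the curves driven by themselves. *)
Definition driven_by x u := forall (t : R) (v : V), 0 <= t ->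
  is_derive t 1 (fun s => u s v) (F (x t) v).

Let weight (t : R) : R := expR (2 * L * t).

Let B_ge0 (v : V) : 0 <= B.
Proof. exact: le_trans (F_bounded (fun=> 0) v). Qed.

Let linear_le_weight (v : V) t : B * t <= B / (2 * L) * weight t.
Proof.
rewrite -mulrA ler_wpM2l ?(B_ge0 v) // mulrC ler_pdivlMr ?mulr_gt0 // mulrC.
by rewrite (le_trans _ (expR_ge1Dx _)) // lerDr.
Qed.

Lemma driven_by_lipschitz x u : driven_by x u -> forall s t v,
  0 <= s -> 0 <= t -> `|u s v - u t v| <= B * `|s - t|.
Proof.
move=> xu s t v.
by apply: (derive_bounded_lipschitz (fun r => xu r v)) => r _; exact: F_bounded.
Qed.

(** The difference u - w has derivative at most L D exp (2 L t), which is the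
    derivative of D / 2 exp (2 L t). *)
Lemma driven_by_contraction x y u w D : driven_by x u -> driven_by y w ->
  u 0 = w 0 -> (forall t v, 0 <= t -> `|x t v - y t v| <= D * weight t) ->
  forall t v, 0 <= t -> `|u t v - w t v| <= D / 2 * weight t.
Proof.
move=> xu yw uw0 xy t v t0.
have D0 : 0 <= D.
  have := xy 0 v (lexx 0); rewrite /weight mulr0 expR0 mulr1.
  exact: le_trans.
pose g s := D / 2 * weight s.
have dg s : is_derive s (1 : R) g (L * (D * weight s)).
  have dl : is_derive s (1 : R) ((2 * L) \*: (@id R)) ((2 * L) *: (1 : R^o)).
    exact: is_deriveZ.
  have := is_deriveZ (D / 2) (is_derive1_comp (is_derive_expR _) dl).
  congr is_derive.
  by rewrite /weight /GRing.scale /=; field.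
have := derive_increment_le (f := fun s => u s v - w s v) (g := g) t0
  (fun s s0 => is_deriveB (xu s v s0) (yw s v s0)) (fun s _ => dg s).
rewrite uw0 subrr subr0 => H; apply: le_trans (H _) _ => [s s0|].
  by apply: F_lipschitz => v'; exact: xy.
by rewrite gerBl mulr_ge0 ?divr_ge0 ?expR_ge0.
Qed.

(** Both curves are B-Lipschitz, so their distance is at most a multiple of the
    weight; and each of them is its own Picard step, so the distance can be
    halved any number of times. *)
Lemma driven_by_self_unique u w : driven_by u u -> driven_by w w ->
  u 0 = w 0 -> forall t, 0 <= t -> u t = w t.
Proof.
move=> uu ww uw0.
have H n : forall t v, 0 <= t -> `|u t v - w t v| <= B / L / 2 ^+ n * weight t.
  elim: n => [|n IH] t v t0.
    have := driven_by_lipschitz uu v t0 (lexx 0).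
    have := driven_by_lipschitz ww v t0 (lexx 0).
    have := linear_le_weight v t.
    rewrite subr0 (ger0_norm t0) uw0 expr0 divr1.
    have -> : B / (2 * L) * weight t = B / L * weight t / 2 by field; rewrite gt_eqF.
    rewrite !ler_norml => h /andP[? ?] /andP[? ?]; apply/andP; split; lra.
  have := driven_by_contraction uu ww uw0 IH v t0.
  by rewrite exprSr invfM mulrA.
move=> t t0; apply/funext => v; apply/eqP; rewrite -subr_eq0 -normr_le0.
apply: (@le_add_geometric _ _ _ (B / L * weight t)) => n.
by rewrite add0r mulrAC H.
Qed.

Lemma driven_by_exists (x0 : V -> R) x :
  (forall s t v, 0 <= s -> 0 <= t -> `|x s v - x t v| <= B * `|s - t|) ->
  exists u, u 0 = x0 /\ driven_by x u.
Proof.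
move=> xlip.
have /choice[G HG] (v : V) : exists G : R -> R, G 0 = 0 /\
    forall t : R, 0 <= t -> is_derive t 1 G (F (x t) v).
  apply: (lipschitz_antiderivative (C := L * B)) => s t s0 t0.
  by rewrite -mulrA; apply: F_lipschitz => v'; exact: xlip.
exists (fun t v => x0 v + G v t); split.
  by apply/funext => v; rewrite (HG v).1 addr0.
move=> t v t0.
have : is_derive t (1 : R) (cst (x0 v) + G v) (0 + F (x t) v).
  by have := (HG v).2 t t0; exact: is_deriveD.
by rewrite add0r.
Qed.

(** All Picard iterates are B-Lipschitz, hence so is their limit x, and the step
    from x is available; the contraction then forces this step to return x. *)
Lemma driven_by_self_exists (x0 : V -> R) : exists u, u 0 = x0 /\ driven_by u u.
Proof.
pose lip x := forall (s t : R) (v : V), 0 <= s -> 0 <= t ->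
  `|x s v - x t v| <= B * `|s - t|.
have /choice[P HP] x : exists u, lip x -> u 0 = x0 /\ driven_by x u.
  have [/(driven_by_exists x0)[u ?]|?] := pselect (lip x); first by exists u.
  by exists x.
pose X n := iter n P (fun=> x0).
have Xlip n : lip (X n).
  elim: n => [|n /HP[_ /driven_by_lipschitz//]] s t v _ _.
  by rewrite subrr normr0 mulr_ge0 ?(B_ge0 v).
have X0 n : X n 0 = x0 by case: n => // n; have [] := HP _ (Xlip n).
have XS n : driven_by (X n) (X n.+1) by have [] := HP _ (Xlip n).
(* B t <= D exp (2 L t), the bound of [linear_le_weight], starts the iteration. *)
pose D := B / (2 * L).
have Xinc n : forall (t : R) (v : V), 0 <= t ->
    `|X n.+1 t v - X n t v| <= D / 2 ^+ n * weight t.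
  elim: n => [|n IH] t v t0.
    rewrite expr0 divr1 (le_trans _ (linear_le_weight v t)) //.
    by have := Xlip 1%N t 0 v t0 (lexx 0); rewrite X0 subr0 (ger0_norm t0).
  have := driven_by_contraction (XS _) (XS _) _ IH v t0.
  by rewrite !X0 exprSr invfM mulrA; apply.
have /choice[x Hx] (t : R) : exists xt : V -> R, 0 <= t -> forall n v,
    `|X n t v - xt v| <= 2 * D / 2 ^+ n * weight t.
  have [t0|] := leP 0 t; last by exists x0.
  have /choice[xt Hxt] (v : V) : exists l, forall n,
      `|X n t v - l| <= 2 * (D * weight t) / 2 ^+ n.
    by apply: geometric_increments_limit => n; rewrite mulrAC Xinc.
  by exists xt => _ n v; have := Hxt v n; rewrite mulrA mulrAC.
have xlip : lip x.
  move=> s t v s0 t0.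
  apply: (@le_add_geometric _ _ _ (2 * D * weight s + 2 * D * weight t)) => n.
  have := Xlip n s t v s0 t0; have := Hx s s0 n v; have := Hx t t0 n v.
  have -> : (2 * D * weight s + 2 * D * weight t) / 2 ^+ n =
    2 * D / 2 ^+ n * weight s + 2 * D / 2 ^+ n * weight t.
    by field; rewrite expf_neq0.
  rewrite !ler_norml.
  by move=> /andP[? ?] /andP[? ?] /andP[? ?]; apply/andP; split; lra.
(* The step u from x equals x on t >= 0, since both are limits of the iterates;
   at negative times u and x may differ, so the solution is u and not x. *)
have [u0 xu] := HP _ xlip; set u := P x in u0 xu.
suff ux t : 0 <= t -> u t = x t.
  by exists u; split=> // t v t0; rewrite ux //; exact: xu.
move=> t0; apply/funext => v; apply/eqP; rewrite -subr_eq0 -normr_le0.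
apply: (@le_add_geometric _ _ _ (2 * (D * weight t))) => n; rewrite add0r.
have xX s v' : 0 <= s -> `|x s v' - X n s v'| <= 2 * D / 2 ^+ n * weight s.
  by move=> s0; rewrite distrC Hx.
have := Hx t t0 n.+1 v.
have := driven_by_contraction xu (XS n) (etrans u0 (esym (X0 n.+1))) xX v t0.
rewrite -[2 * D / 2 ^+ n * _]mulrA exprSr invfM mulrA.
have -> : 2 * D / 2 ^+ n / 2 * weight t = D * weight t / 2 ^+ n.
  by field; rewrite expf_neq0.
rewrite -mulrA !ler_norml => /andP[? ?] /andP[? ?]; apply/andP; split; lra.
Qed.

Theorem bounded_lipschitz_flow (x0 : V -> R) :
  has_unique_flow_solution [set: V -> R] F x0.
Proof.
have [u [u0 uu]] := driven_by_self_exists x0.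
exists u; split.
  split=> // t v t0; apply: is_derive_within (uu t v t0) => //.
  by rewrite /= in_itv /= t0.
move=> y [y0 _ dy] t t0.
pose w s v := affine_extension (fun r => y r v) (F (y 0) v) s.
have wE s : 0 <= s -> w s = y s.
  by move=> s0; apply/funext => v; exact: affine_extensionE.
rewrite -(wE t) //; apply: driven_by_self_unique => //.
  move=> s v s0; rewrite wE //.
  exact: (is_derive_affine_extension (df := fun r => F (y r) v) (fun r => dy r v)).
by rewrite wE // y0 u0.
Qed.

End BoundedLipschitzFlow.

(** * Angles of the circle pattern in logarithmic coordinates *)

Section LogRadius.
Variable R : realType.
Implicit Types (x y d : R).

(** A single coordinate of [radius_of], to which it is convertible. *)
Definition radius_of_log x : R := atan (expR (- x)).

Lemma radius_of_log_itv x : 0 < radius_of_log x < pi / 2.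
Proof.
by rewrite atan_ltpi2 andbT -(atan0 R); apply/lt_atan/expR_gt0.
Qed.

Lemma cos_radius_of_log_gt0 x : 0 < cos (radius_of_log x).
Proof.
have /andP[r0 r1] := radius_of_log_itv x.
by rewrite cos_gt0_pihalf // r1 andbT (lt_trans _ r0) // oppr_lt0 divr_gt0 ?pi_gt0.
Qed.

Lemma sin_radius_of_log x :
  sin (radius_of_log x) = expR (- x) * cos (radius_of_log x).
Proof.
rewrite -[X in X * _](atanK (expR (- x))) -/(radius_of_log x) /tan divfK //.
by rewrite gt_eqF ?cos_radius_of_log_gt0.
Qed.

Lemma cos_radius_of_log x :
  cos (radius_of_log x) = (Num.sqrt (1 + expR (- x) ^+ 2))^-1.
Proof. exact: cos_atan. Qed.

Lemma is_derive_radius_of_log x :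
  is_derive x 1 radius_of_log (- (sin (2 * radius_of_log x) / 2)).
Proof.
have D : is_derive x (1 : R) (expR \o -%R) (expR (- x) * (-1)).
  exact: is_derive1_comp.
have := is_derive1_comp (is_derive1_atan _) D; congr is_derive.
have s0 : 0 < 1 + expR (- x) ^+ 2 by rewrite ltr_pwDl ?sqr_ge0.
have q2 : cos (radius_of_log x) ^+ 2 = (1 + expR (- x) ^+ 2)^-1.
  by rewrite cos_radius_of_log exprVn sqr_sqrtr ?ltW.
rewrite mulr_natl sin_mulr2n sin_radius_of_log /= -q2.
by field.
Qed.

Lemma radius_of_log_lipschitz x y :
  `|radius_of_log x - radius_of_log y| <= `|x - y|.
Proof.
rewrite -[leRHS]mul1r.
apply: (derive_bounded_lipschitz (a := Num.min x y)
    (fun t _ => is_derive_radius_of_log t)); rewrite ?ge_min ?lexx ?orbT //.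
move=> t _; have := sin_max (2 * radius_of_log t); rewrite !ler_norml.
by move=> /andP[? ?]; apply/andP; split; lra.
Qed.

Lemma cos_lipschitz x y : `|cos x - cos y| <= `|x - y|.
Proof.
rewrite -[leRHS]mul1r.
apply: (derive_bounded_lipschitz (a := Num.min x y)
    (fun t _ => is_derive_cos t)); rewrite ?ge_min ?lexx ?orbT //.
by move=> t _; rewrite normrN sin_max.
Qed.

Lemma is_derive_ln_cot x : 0 < x < pi / 2 ->
  is_derive x 1 (fun y => ln (cot y)) (- 2 / sin (2 * x)).
Proof.
move=> /andP[x0 x1].
have c0 : 0 < cos x.
  by rewrite cos_gt0_pihalf // x1 andbT (lt_trans _ x0) // oppr_lt0 divr_gt0 ?pi_gt0.
have s0 : 0 < sin x by rewrite sin_gt0_pihalf // x0.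
have Dc : is_derive x (1 : R) (@cot R) (- (sin x)^-2).
  have := is_deriveM (is_derive_cos x) (is_deriveV (lt0r_neq0 s0) (is_derive_sin x)).
  congr is_derive; rewrite /GRing.scale /=.
  transitivity (- (cos x ^+ 2 + sin x ^+ 2) / sin x ^+ 2).
    by field; rewrite gt_eqF.
  by rewrite cos2Dsin2 mulN1r.
have := is_derive1_comp (g := @cot R) (is_derive1_ln (divr_gt0 c0 s0)) Dc; congr is_derive.
rewrite mulr_natl sin_mulr2n -mulr_natl invf_div.
by field; rewrite !gt_eqF.
Qed.

(** As cos r = 1 / sqrt (1 + exp (- 2 x)), moving x by d scales 1 + exp (- 2 x) by
    at most exp (2 d). *)
Lemma cos_radius_of_log_le x y d : `|x - y| <= d ->
  cos (radius_of_log x) <= expR d * cos (radius_of_log y).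
Proof.
rewrite ler_norml => /andP[xy1 xy2].
rewrite !cos_radius_of_log ler_pdivlMr ?sqrtr_gt0 ?ltr_pwDl ?sqr_ge0 //.
rewrite mulrC ler_pdivrMr ?sqrtr_gt0 ?ltr_pwDl ?sqr_ge0 //.
rewrite -(ger0_norm (expR_ge0 d)) -sqrtr_sqr -sqrtrM ?sqr_ge0 // ler_wsqrtr //.
have d0 : 0 <= d by lra.
rewrite mulrDr mulr1 lerD ?expr_ge1 -?expR0 ?ler_expR //.
by rewrite -exprMn lerXn2r ?nnegrE ?mulr_ge0 ?expR_ge0 // -expRD ler_expR; lra.
Qed.

End LogRadius.

Section Angle.
Variable R : realType.
Implicit Types (a b g x y d theta : R).

(** The four-part formula
      cot (angle at u) * sin g = sin a * cot b - cos a * cos g,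
    with the inverse cotangent written as pi / 2 - arctan, which has its values
    between 0 and pi as an angle of a triangle should. *)
Lemma triangle_angleE a b g : 0 < a < pi -> 0 < b < pi -> 0 < g < pi ->
  triangle_angle a b g =
    pi / 2 - atan ((sin a * cot b - cos a * cos g) / sin g).
Proof.
move=> ha hb hg.
have sa : 0 < sin a by rewrite sin_gt0_pi.
have sb : 0 < sin b by rewrite sin_gt0_pi.
have sg : 0 < sin g by rewrite sin_gt0_pi.
set c := _ / sin g.
rewrite /triangle_angle sphere_angleE; [|exact: vertex_u_sphere
  |exact: apex_sphere|exact: vertex_w_sphere].
rewrite !dot_vec3 !(mulr0, mul0r, mulr1, mul1r, add0r, addr0) sqrt_sin //.
have -> : 1 - (sin a * (sin b * cos g) + cos a * cos b) ^+ 2 =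
    (sin b * sin g) ^+ 2 * (1 + c ^+ 2).
  have -> : (sin b * sin g) ^+ 2 * (1 + c ^+ 2) = (sin b * sin g) ^+ 2 +
      (sin a * cos b - cos a * sin b * cos g) ^+ 2.
    by rewrite /c /cot; field; rewrite !gt_eqF.
  have -> : (sin b * sin g) ^+ 2 = sin b ^+ 2 * (1 - cos g ^+ 2).
    by rewrite exprMn -sin2cos2.
  (* The components of the vertex w along u and along the direction from u to the
     apex have squares that sum up to sin b ^ 2 * cos g ^ 2 + cos b ^ 2. *)
  have -> : 1 - (sin a * (sin b * cos g) + cos a * cos b) ^+ 2 =
      1 - (cos a ^+ 2 + sin a ^+ 2) * (sin b ^+ 2 * cos g ^+ 2 + cos b ^+ 2)
      + (sin a * cos b - cos a * sin b * cos g) ^+ 2 by ring.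
  by rewrite cos2Dsin2 -[X in X - _](cos2Dsin2 b); ring.
have q0 : 0 < Num.sqrt (1 + c ^+ 2) by rewrite sqrtr_gt0 ltr_pwDl ?sqr_ge0.
rewrite sqrtrM ?sqr_ge0 // sqrtr_sqr ger0_norm ?mulr_ge0 ?ltW //.
have -> : (cos b - cos a * (sin a * (sin b * cos g) + cos a * cos b)) /
    (sin a * (sin b * sin g * Num.sqrt (1 + c ^+ 2))) =
    c / Num.sqrt (1 + c ^+ 2).
  have -> : cos b - cos a * (sin a * (sin b * cos g) + cos a * cos b) =
      sin a * (sin a * cos b - cos a * sin b * cos g).
    transitivity ((1 - cos a ^+ 2) * cos b - sin a * cos a * sin b * cos g).
      by ring.
    by rewrite -sin2cos2; ring.
  move: (Num.sqrt _) q0 => q q0.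
  by rewrite /c /cot; field; rewrite !gt_eqF.
have -> : c / Num.sqrt (1 + c ^+ 2) = cos (pi / 2 - atan c).
  rewrite -cosN opprB cosBpihalf -cos_atan -[X in X * _]atanK /tan divfK //.
  by rewrite cos_atan invr_eq0 gt_eqF.
rewrite cosK // in_itv /=; have := atan_gtNpi2 c; have := atan_ltpi2 c.
by move=> ? ?; apply/andP; split; lra.
Qed.

(** The cotangent of the angle beta of an edge, by the four-part formula with
    sin r = exp (- x) * cos r and cot (radius at w) = exp y. *)
Definition angle_cot theta x y : R :=
  (expR (y - x) + cos theta) * cos (radius_of_log x) / sin theta.

Lemma triangle_angle_log theta x y : 0 < theta < pi ->
  triangle_angle (radius_of_log x) (radius_of_log y) (pi - theta) =
    pi / 2 - atan (angle_cot theta x y).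
Proof.
move=> /andP[t0 t1].
have itv z : 0 < radius_of_log z < pi.
  have /andP[-> /lt_le_trans-> //] := radius_of_log_itv z.
  by rewrite ler_pdivrMr // ler_peMr ?pi_ge0 // ler1n.
rewrite triangle_angleE //; last by apply/andP; split; lra.
congr (_ - atan _).
have -> : cot (radius_of_log y) = expR y.
  rewrite /cot sin_radius_of_log expRN invfM invrK mulrCA divff ?mulr1 //.
  by rewrite gt_eqF ?cos_radius_of_log_gt0.
rewrite (addrC pi) sinDpi cosDpi sinN cosN opprK sin_radius_of_log /angle_cot.
by congr (_ / _); rewrite expRD; ring.
Qed.

Lemma triangle_angle_log_norm theta x y : 0 < theta < pi ->
  `|triangle_angle (radius_of_log x) (radius_of_log y) (pi - theta)| <= pi.
Proof.
move=> /triangle_angle_log->; have := atan_gtNpi2 (angle_cot theta x y).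
have := atan_ltpi2 (angle_cot theta x y).
by rewrite ler_norml => ? ?; apply/andP; split; lra.
Qed.

Lemma angle_cot_gt0 theta x y : 0 < theta <= pi / 2 -> 0 < angle_cot theta x y.
Proof.
move=> /andP[t0 t1].
have t2 : theta < pi by have := pi_gt0 R; lra.
rewrite divr_gt0 ?sin_gt0_pi ?t0 // mulr_gt0 ?cos_radius_of_log_gt0 //.
rewrite ltr_pwDl ?expR_gt0 // cos_ge0_pihalf // t1 andbT.
by have := pi_gt0 R; lra.
Qed.

(** The factor exp (y - x) + cos theta accounts for 2 d, because adding the
    nonnegative constant cos theta only dampens a relative change; the factor
    cos r accounts for the third d. *)
Lemma angle_cot_le theta x y x' y' d : 0 < theta <= pi / 2 ->
  `|x - x'| <= d -> `|y - y'| <= d ->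
  angle_cot theta x y <= expR (3 * d) * angle_cot theta x' y'.
Proof.
move=> /andP[t0 t1] hx hy.
have t2 : theta < pi by have := pi_gt0 R; lra.
have expR_diff : expR (y - x) <= expR (2 * d) * expR (y' - x').
  rewrite -expRD ler_expR; move: hx hy.
  by rewrite !ler_norml => /andP[? ?] /andP[? ?]; lra.
have expR_ge1 : 1 <= expR (2 * d).
  by rewrite -expR0 ler_expR mulr_ge0 // (le_trans _ hx).
have c0 : 0 <= cos theta.
  by rewrite cos_ge0_pihalf // t1 andbT; have := pi_gt0 R; lra.
rewrite /angle_cot !mulrA ler_pM2r ?invr_gt0 ?sin_gt0_pi ?t0 //.
have -> : 3 * d = 2 * d + d by ring.
rewrite [expR (2 * d + d)]expRD -!mulrA [expR d * _]mulrCA.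
rewrite [expR (2 * d) * _]mulrA.
have := cos_radius_of_log_le hx; apply: ler_pM.
- by rewrite addr_ge0 ?expR_ge0.
- by rewrite ltW ?cos_radius_of_log_gt0.
by rewrite mulrDr lerD // ler_peMl.
Qed.

(** The angle is pi / 2 minus the arctangent of the exponential of ln (cot beta),
    and arctan o exp is 1-Lipschitz. *)
Lemma triangle_angle_log_lipschitz theta x y x' y' d : 0 < theta <= pi / 2 ->
  `|x - x'| <= d -> `|y - y'| <= d ->
  `|triangle_angle (radius_of_log x) (radius_of_log y) (pi - theta) -
    triangle_angle (radius_of_log x') (radius_of_log y') (pi - theta)| <= 3 * d.
Proof.
move=> ht hx hy.
have t2 : 0 < theta < pi by have := pi_gt0 R; case/andP: ht => ? ? ?; lra.
rewrite !triangle_angle_log //.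
set c := angle_cot _ x y; set c' := angle_cot _ x' y'.
have c0 : 0 < c by exact: angle_cot_gt0.
have c'0 : 0 < c' by exact: angle_cot_gt0.
have atan_ln z : 0 < z -> atan z = radius_of_log (- ln z).
  by move=> z0; rewrite /radius_of_log opprK lnK.
have -> (p q r : R) : p - q - (p - r) = r - q by ring.
rewrite !atan_ln // (le_trans (radius_of_log_lipschitz _ _)) // opprK addrC.
have ln_le z z' : 0 < z -> 0 < z' -> z <= expR (3 * d) * z' ->
    ln z <= 3 * d + ln z'.
  move=> z0 z'0 zz'; rewrite -[3 * d]expRK -lnM ?posrE ?expR_gt0 //.
  by rewrite ler_ln ?posrE ?mulr_gt0 ?expR_gt0.
have h1 := ln_le _ _ c0 c'0 (angle_cot_le ht hx hy).
move: hx hy; rewrite distrC => hx; rewrite distrC => hy.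
have h2 := ln_le _ _ c'0 c0 (angle_cot_le ht hx hy).
by rewrite ler_norml; apply/andP; split; lra.
Qed.

End Angle.

(** * The two curvature flows *)

Section CurvatureField.
Variables (R : realType) (V E : finType) (ends : E -> {set V}).
Variables (Theta : E -> R) (Lhat : V -> R).
Hypothesis Theta_range : forall e, 0 < Theta e <= pi / 2.
Implicit Types (K : V -> R) (v w : V) (e : E).

Lemma norm_sum_le_card (I : finType) (P : pred I) (f : I -> R) c : 0 <= c ->
  (forall i, `|f i| <= c) -> `|\sum_(i | P i) f i| <= c * #|I|%:R.
Proof.
move=> c0 fc; rewrite (le_trans (ler_norm_sum _ _ _)) //.
rewrite (le_trans (ler_sum _ (fun i _ => fc i))) // sumr_const -[c *+ _]mulr_natr.
by rewrite ler_wpM2l // ler_nat max_card.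
Qed.

Definition edge_curvature K v w e : R :=
  2 * beta Theta (radius_of K) v w e * cos (radius_of K v).

Lemma total_curvature_edges K v : total_curvature ends Theta (radius_of K) v =
  \sum_(e | v \in ends e) \sum_(w in ends e :\ v) edge_curvature K v w e.
Proof.
rewrite total_curvatureE; last exact: radius_of_admissible.
rewrite /cone_angle mulr_suml; apply: eq_bigr => e _.
by rewrite mulr_suml.
Qed.

Lemma edge_curvature_norm K v w e : `|edge_curvature K v w e| <= 2 * pi.
Proof.
have t2 : 0 < Theta e < pi.
  by have := pi_gt0 R; case/andP: (Theta_range e) => ? ? ?; lra.
rewrite !normrM normr_nat -mulrA ler_wpM2l //.
rewrite -[leRHS]mulr1 ler_pM // ?cos_max //.
exact: triangle_angle_log_norm.
Qed.

(** The constant is 2 * (3 * 1 + pi * 1): a Lipschitz constant of one factor times a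
    bound of the other, for the factors beta and cos r. *)
Lemma edge_curvature_lipschitz K K' d v w e :
  (forall v, `|K v - K' v| <= d) ->
  `|edge_curvature K v w e - edge_curvature K' v w e| <= (6 + 2 * pi) * d.
Proof.
move=> KK'.
have t2 : 0 < Theta e < pi.
  by have := pi_gt0 R; case/andP: (Theta_range e) => ? ? ?; lra.
rewrite /edge_curvature /beta.
have := triangle_angle_log_norm (K' v) (K' w) t2.
have := triangle_angle_log_lipschitz (Theta_range e) (KK' v) (KK' w).
rewrite -!/(radius_of _ _).
set b := triangle_angle _ _ _; set b' := triangle_angle _ _ _ => bb' b'pi.
have cc' : `|cos (radius_of K v) - cos (radius_of K' v)| <= d.
  apply: le_trans (KK' v); apply: le_trans (cos_lipschitz _ _) _.
  exact: radius_of_log_lipschitz.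
move: (cos _) (cos_max (radius_of K v)) cc' => c c1.
move: (cos _) => c' cc'.
have -> : 2 * b * c - 2 * b' * c' = 2 * ((b - b') * c + b' * (c - c')) by ring.
have -> : (6 + 2 * pi) * d = 2 * (3 * d * 1 + pi * d) by ring.
rewrite normrM normr_nat ler_wpM2l // (le_trans (ler_normD _ _)) // !normrM.
by rewrite lerD // ler_pM.
Qed.

Lemma log_curvature_flow_bounded : exists B, forall K v,
  `|log_curvature_flow ends Theta Lhat K v| <= B.
Proof.
exists (2 * pi * #|V|%:R * #|E|%:R + \sum_v `|Lhat v|) => K v.
have pi2 : 0 <= 2 * (pi : R) by rewrite mulr_ge0 ?pi_ge0.
rewrite /log_curvature_flow normrN (le_trans (ler_normB _ _)) // lerD //.
  rewrite total_curvature_edges norm_sum_le_card ?mulr_ge0 ?pi_ge0 // => e.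
  by rewrite norm_sum_le_card // => w; exact: edge_curvature_norm.
by rewrite (bigD1 v) //= lerDl sumr_ge0.
Qed.

Lemma log_curvature_flow_lipschitz : exists2 L, 0 < L &
  forall K K' d, (forall v, `|K v - K' v| <= d) -> forall v,
    `|log_curvature_flow ends Theta Lhat K v -
      log_curvature_flow ends Theta Lhat K' v| <= L * d.
Proof.
pose C : R := (6 + 2 * pi) * #|V|%:R * #|E|%:R.
have pi6 : 0 <= 6 + 2 * (pi : R) by rewrite addr_ge0 // mulr_ge0 ?pi_ge0.
exists (C + 1) => [|K K' d KK' v].
  by rewrite ltr_wpDl // !mulr_ge0.
have d0 : 0 <= d by exact: le_trans (KK' v).
rewrite /log_curvature_flow !total_curvature_edges.
have -> (p q r : R) : - (p - q) - - (r - q) = - (p - r) by ring.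
rewrite normrN -sumrB (@le_trans _ _ (C * d)) //; last first.
  by rewrite ler_wpM2r // lerDl.
have -> : C * d = (6 + 2 * pi) * d * #|V|%:R * #|E|%:R by rewrite /C; ring.
rewrite norm_sum_le_card ?mulr_ge0 // => e; rewrite -sumrB.
rewrite norm_sum_le_card ?mulr_ge0 // => w.
exact: edge_curvature_lipschitz.
Qed.

Theorem log_curvature_flow_solution (K0 : V -> R) :
  has_unique_flow_solution [set: V -> R]
    (log_curvature_flow ends Theta Lhat) K0.
Proof.
have [B HB] := log_curvature_flow_bounded.
have [L L0 HL] := log_curvature_flow_lipschitz.
exact: bounded_lipschitz_flow HB L0 HL K0.
Qed.

End CurvatureField.

Section RadiusFlow.
Variables (R : realType) (V E : finType) (ends : E -> {set V}).
Variables (Theta : E -> R) (Lhat : V -> R).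

(** By the chain rule, since dr / dK = - sin (2 r) / 2. *)
Lemma radius_flow_of_log_flow (K0 : V -> R) K :
  flow_solution [set: V -> R] (log_curvature_flow ends Theta Lhat) K0 K ->
  flow_solution (@admissible_radii R V) (radius_flow ends Theta Lhat)
    (radius_of K0) (fun t => radius_of (K t)).
Proof.
move=> [K00 _ dK]; split; first by rewrite K00.
  by move=> t _; exact: radius_of_admissible.
move=> t v t0.
have := has_derivative_within_comp
  (dphi := fun x => - (sin (2 * radius_of_log x) / 2)) (fun s => dK s v)
  (fun s _ => is_derive_radius_of_log (K s v)) t0.
by congr has_derivative_within; rewrite /radius_flow /log_curvature_flow; field.
Qed.

(** The converse change of variables carries uniqueness over to the radius flow:
    dK / dr = - 2 / sin (2 r). *)
Lemma log_flow_of_radius_flow (r0 : V -> R) r :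
  flow_solution (@admissible_radii R V) (radius_flow ends Theta Lhat) r0 r ->
  flow_solution [set: V -> R] (log_curvature_flow ends Theta Lhat)
    (log_curvature r0) (fun t => log_curvature (r t)).
Proof.
move=> [r00 ar dr]; split=> [|//|t v t0]; first by rewrite r00.
have := has_derivative_within_comp
  (dphi := fun x => - 2 / sin (2 * x)) (fun s => dr s v)
  (fun s s0 => is_derive_ln_cot (ar s s0 v)) t0.
congr has_derivative_within; rewrite /radius_flow /log_curvature_flow.
have -> : radius_of (log_curvature (r t)) = r t.
  by apply/funext; exact/log_curvatureK/ar.
have /andP[? ?] := ar t t0 v.
have s0 : 0 < sin (2 * r t v) by rewrite sin_gt0_pi //; apply/andP; split; lra.
by field; rewrite gt_eqF.
Qed.

End RadiusFlow.

Theorem theorem3p1 (R : realType) (Sigma : topologicalType)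
    (V E : finType) (ends : E -> {set V})
    (eta_v : V -> Sigma) (eta_e : E -> set Sigma)
    (Theta : E -> R) (Lhat : V -> R)
    (surface_Sigma : closed_surface R Sigma)
    (embedding_G : closed_2cell_embedding R ends eta_v eta_e)
    (Theta_range : forall e, 0 < Theta e <= pi / 2)
    (Lhat_gt0 : forall v, 0 < Lhat v) :
  (forall r0 : V -> R, (forall v, 0 < r0 v < pi / 2) ->
     has_unique_flow_solution [set r | forall v, 0 < r v < pi / 2]
       (radius_flow ends Theta Lhat) r0) /\
  (forall K0 : V -> R,
     has_unique_flow_solution [set: V -> R]
       (log_curvature_flow ends Theta Lhat) K0).
Proof.
have log_flow := log_curvature_flow_solution ends Lhat Theta_range.
split=> // r0 ar0.
have [K [solK uniqK]] := log_flow (log_curvature r0).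
exists (fun t => radius_of (K t)); split.
  rewrite -[in X in flow_solution _ _ X _](_ : radius_of (log_curvature r0) = r0).
    exact: radius_flow_of_log_flow.
  by apply/funext; exact: log_curvatureK.
move=> r solr t t0; rewrite -(uniqK _ (log_flow_of_radius_flow solr)) //.
by have [_ ar _] := solr; apply/funext => v; rewrite log_curvatureK //; exact: ar.
Qed.
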